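(* Assume the location-scale assumption holds with standardized variable $\xi$. Let $\rho_{M}$ denote either of the estimators $\rho_{\mathrm{BS}}$ or $\rho_{\mathrm{DBS}}$. Then: (i) if the losses have an unbounded right tail (i.e. $\mathbb{P}(\xi\ge y)>0$ for every $y\in\mathbb{R}$), then $\rho_{\mathbb{P}}(\ell(z,\eta))-\mathbb{E}[\rho_M]=\omega\big(\sqrt{\mathrm{Var}(\ell(z,\eta))}\big)$; (ii) if the losses are normally distributed, then $\rho_{\mathbb{P}}(\ell(z,\eta))-\mathbb{E}[\rho_M]=\Omega\big(\mathrm{Var}(\ell(z,\eta))\big)$; (iii) if $\xi$ follows the Laplace distribution with density $\frac1{\sqrt2}e^{-\sqrt2|x|}$, then $\rho_{\mathbb{P}}(\ell(z,\eta))-\mathbb{E}[\rho_M]\to\infty$ as $\mathrm{Var}(\ell(z,\eta))\to2/\alpha^2$; (iv) if the losses have subgaussian tails (equivalently, $\xi$ does), then $\big|\rho_{\mathbb{P}}(\ell(z,\eta))-\mathbb{E}[\rho_M]\big|=\mathcal{O}\big(\mathrm{Var}(\ell(z,\eta))\big)$.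
   Context: Fix a risk aversion parameter $\alpha>0$ and an integer $N\ge 1$. $\mathcal{Z}\subseteq\mathbb{R}^d$ is a set of decisions, $\eta$ is a random vector with law $\mathbb{P}$, and $\ell(z,\eta)$ is a real random loss for each $z\in\mathcal{Z}$. For a distribution $\mathbb{Q}$, $\rho_{\mathbb{Q}}(X)=\frac1\alpha\log\mathbb{E}_{\mathbb{Q}}[\exp(\alpha X)]\in(-\infty,+\infty]$ is the entropic risk. $\hat{\mathbb{P}}_N$ is the empirical distribution of i.i.d. samples $\hat\eta_1,\dots,\hat\eta_N$ from $\mathbb{P}$. $\hat{\mathbb{P}}_{N,N}$ is the empirical distribution of $N$ i.i.d. draws from $\hat{\mathbb{P}}_N$, and $\hat{\mathbb{P}}_{N,N,N}$ is the empirical distribution of $N$ i.i.d. draws from $\hat{\mathbb{P}}_{N,N}$. The bootstrap and double bootstrap estimators are $$\rho_{\mathrm{BS}}:=2\rho_{\hat{\mathbb{P}}_N}(\ell(z,\eta))-\mathbb{E}[\rho_{\hat{\mathbb{P}}_{N,N}}(\ell(z,\eta))\,|\,\hat{\mathbb{P}}_N],$$ $$\rho_{\mathrm{DBS}}:=3\rho_{\hat{\mathbb{P}}_N}(\ell(z,\eta))-3\,\mathbb{E}[\rho_{\hat{\mathbb{P}}_{N,N}}(\ell(z,\eta))\,|\,\hat{\mathbb{P}}_N]+\mathbb{E}[\rho_{\hat{\mathbb{P}}_{N,N,N}}(\ell(z,\eta))\,|\,\hat{\mathbb{P}}_N].$$ The unconditional expectation $\mathbb{E}$ in the claim is over the samples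 $\hat\eta_1,\dots,\hat\eta_N$. Location-scale assumption: there are a fixed real random variable $\xi$ with $\mathbb{E}[\xi]=0$, $\mathbb{E}[\xi^2]=1$ and a set $\mathcal{A}\subset\mathbb{R}\times\mathbb{R}_+$ such that the set of distributions of $\{\ell(z,\eta):z\in\mathcal{Z}\}$ equals the set of distributions of $\{\mu+\sigma\xi:(\mu,\sigma)\in\mathcal{A}\}$. A random variable $X$ has subgaussian tails if there is $\mathfrak{c}_0>0$ with $\mathbb{P}(|X|\ge a)\le 2\exp(-a^2/\mathfrak{c}_0^2)$ for all $a\ge0$. Asymptotic notation: $\alpha$, $N$ and the law of $\xi$ are fixed, and quantities are considered as $\sigma=\sqrt{\mathrm{Var}(\ell(z,\eta))}$ varies. $f=\mathcal{O}(g(\sigma))$: there are $c,\bar\sigma>0$ with $f\le c\,g(\sigma)$ whenever $\sigma\ge\bar\sigma$. $f=\Omega(g(\sigma))$: there are $c,\bar\sigma>0$ with $c\,g(\sigma)\le f$ whenever $\sigma\ge\bar\sigma$. $f=\omega(g(\sigma))$: for every $c>0$ there is $\bar\sigma>0$ with $c\,g(\sigma)\le f$ whenever $\sigma\ge\bar\sigma$. *)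

(* Defs.v *)
From HB Require Import structures.
From mathcomp Require Export all_boot all_order all_algebra.
From mathcomp Require Export all_classical all_reals all_analysis.

Set Implicit Arguments.
Unset Strict Implicit.
Unset Printing Implicit Defensive.

Export Order.TTheory GRing.Theory Num.Theory.
Export numFieldNormedType.Exports.

Local Open Scope classical_set_scope.
Local Open Scope ring_scope.

Section iid_law.
Context {d : measure_display} {T : measurableType d} {R : realType}.

Definition tuple_cons (n : nat) (p : T * n.-tuple T) : n.+1.-tuple T :=
  [tuple of p.1 :: p.2].

Lemma measurable_tuple_cons n : measurable_fun [set: T * n.-tuple T]%type
  (@tuple_cons n).
Proof. by apply: measurable_cons. Qed.

HB.instance Definition _ n :=
  isMeasurableFun.Build _ _ _ _ (@tuple_cons n) (@measurable_tuple_cons n).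

(* The product law Q^n on n-tuples, i.e. the joint law of n i.i.d. draws
   from Q. *)
Fixpoint iid_law (Q : probability T R) (n : nat)
    : probability (n.-tuple T) R :=
  match n with
  | 0 => \d_([tuple] : 0.-tuple T)
  | n'.+1 => distribution (Q \x iid_law Q n')%E (@tuple_cons n')
  end.

End iid_law.

Section empirical.
Context {d : measure_display} {T : measurableType d} {R : realType} {n : nat}.
Variable x : n.+1.-tuple T.

Definition empirical : set T -> \bar R :=
  mscale (n.+1%:R^-1)%:nng (msum (fun i => \d_(tnth x (inord i))) n.+1).

HB.instance Definition _ := Measure.on empirical.

Let empirical_setT : empirical [set: T] = 1%E.
Proof.
rewrite /empirical /mscale/= /msum.
rewrite (eq_bigr (fun=> 1%E)) => [|i _]; last by rewrite /= diracT.
by rewrite sumEFin sumr_const card_ord -EFinM mulVf// pnatr_eq0.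
Qed.

HB.instance Definition _ := Measure_isProbability.Build _ _ _
  empirical empirical_setT.

End empirical.

Section entropic.
Context {d : measure_display} {T : measurableType d} {R : realType}.
Local Open Scope ereal_scope.

Definition entropic_risk (alpha : R) (Q : probability T R) (X : T -> R)
    : \bar R :=
  (alpha^-1)%:E * lne ('E_Q[fun t => expR (alpha * X t)]).

(* Mean, over n.+1 i.i.d. draws from Q, of the entropic risk under the
   empirical distribution of the draws. At Q = the empirical distribution of
   the sample, this is E[rho_{P_{N,N}} | P_N] with N = n.+1. *)
Definition resampled_risk (n : nat) (alpha : R) (X : T -> R)
    (Q : probability T R) : \bar R :=
  \int[iid_law Q n.+1]_y entropic_risk alpha (empirical y) X.

(* At Q = the empirical distribution of the sample, this is
   E[rho_{P_{N,N,N}} | P_N]. *)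
Definition doubly_resampled_risk (n : nat) (alpha : R) (X : T -> R)
    (Q : probability T R) : \bar R :=
  \int[iid_law Q n.+1]_y resampled_risk n alpha X (empirical y).

Inductive bootstrap_method := BS | DBS.

Definition bootstrap_estimator (M : bootstrap_method) (n : nat) (alpha : R)
    (X : T -> R) (Q : probability T R) : \bar R :=
  match M with
  | BS => 2%:E * entropic_risk alpha Q X - resampled_risk n alpha X Q
  | DBS => 3%:E * entropic_risk alpha Q X
           - 3%:E * resampled_risk n alpha X Q
           + doubly_resampled_risk n alpha X Q
  end.

(* rho_P(X) - E[rho_M], for n.+1 i.i.d. samples from P. *)
Definition risk_gap (M : bootstrap_method) (n : nat) (alpha : R)
    (P : probability T R) (X : T -> R) : \bar R :=
  entropic_risk alpha P X -
  \int[iid_law P n.+1]_x bootstrap_estimator M n alpha X (empirical x).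

Definition std_dev (P : probability T R) (X : T -> R) : R :=
  Num.sqrt (fine 'V_P[X]).

Definition subgaussian_tails (P : probability T R) (X : T -> R) : Prop :=
  exists2 c0 : R, (0 < c0)%R & forall a : R, (0 <= a)%R ->
    P [set t | (a <= `|X t|)%R] <= (2 * expR (- (a ^+ 2 / c0 ^+ 2)))%:E.

Definition unbounded_right_tail (P : probability T R) (X : T -> R) : Prop :=
  forall y : R, 0 < P [set t | (y <= X t)%R].

(* normal_prob _ 0 is not a Dirac mass, hence the separate case. *)
Definition normally_distributed (P : probability T R) (X : T -> R) : Prop :=
  exists m s : R, (0 <= s)%R /\
    forall B : set R, measurable B ->
      P (X @^-1` B) = if s == 0%R then \d_m B else normal_prob m s B.

Definition laplace_distributed (P : probability T R) (X : T -> R) : Prop :=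
  forall B : set R, measurable B ->
    P (X @^-1` B) = \int[lebesgue_measure]_(x in B)
      ((Num.sqrt 2)^-1 * expR (- (Num.sqrt 2 * `|x|)))%:E.

End entropic.

(* Equality is only required on measurable sets: the values of a measure on
   other sets carry no meaning. *)
Definition same_distribution {d d' : measure_display} {T : measurableType d}
    {U : measurableType d'} {R : realType}
    (P : probability T R) (X : T -> R) (Q : probability U R) (Y : U -> R) :=
  forall B : set R, measurable B -> P (X @^-1` B) = Q (Y @^-1` B).

Definition location_scale {D : Type} {d d' : measure_display}
    {T : measurableType d} {U : measurableType d'} {R : realType}
    (Z : set D) (P : probability T R) (ell : D -> T -> R)
    (Pxi : probability U R) (xi : U -> R) (A : set (R * R)) : Prop :=
  [/\ ('E_Pxi[xi] = 0)%E,
      ('E_Pxi[fun w => (xi w ^+ 2)%R] = 1)%E,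
      forall p, A p -> 0 <= p.2,
      forall z, Z z -> exists2 p, A p &
        same_distribution P (ell z) Pxi (fun w => p.1 + p.2 * xi w) &
      forall p, A p -> exists2 z, Z z &
        same_distribution P (ell z) Pxi (fun w => p.1 + p.2 * xi w)].

(* f = O(g(sigma)), Omega(g(sigma)), omega(g(sigma)) for quantities indexed by
   the decisions z in Z, as sigma z grows. *)
Section asymptotics.
Context {D : Type} {R : realType}.
Variables (Z : set D) (sigma : D -> R) (f : D -> \bar R) (g : R -> R).

Definition is_bigO : Prop := exists c sbar : R, [/\ 0 < c, 0 < sbar &
  forall z, Z z -> sbar <= sigma z -> (f z <= (c * g (sigma z))%:E)%E].

Definition is_bigOmega : Prop := exists c sbar : R, [/\ 0 < c, 0 < sbar &
  forall z, Z z -> sbar <= sigma z -> ((c * g (sigma z))%:E <= f z)%E].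

Definition is_smallomega : Prop := forall c : R, 0 < c ->
  exists2 sbar : R, 0 < sbar &
  forall z, Z z -> sbar <= sigma z -> ((c * g (sigma z))%:E <= f z)%E.

End asymptotics.

(* f z --> +oo as v z --> l, for z in Z. *)
Definition diverges_as {D : Type} {R : realType} (Z : set D)
    (v : D -> R) (l : R) (f : D -> \bar R) : Prop :=
  forall K : R, exists2 delta : R, 0 < delta &
    forall z, Z z -> `|v z - l| < delta -> (K%:E <= f z)%E.

(* Main.v *)
Require Import Defs.
From mathcomp Require Import measurable_realfun ring lra.

(** Resampling cannot see beyond the sample.  Write N for the sample size, m
and s for the mean and the standard deviation of the loss X.  The entropic risk
of an empirical distribution lies between the least and the greatest sample
value, hence within the dispersion G = |X_1 - m| + ... + |X_N - m| of m.
Drawing N points from N given points leaves the mean of G unchanged, so the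
resampled and doubly resampled risks are also within G of m.  The coefficients
of either estimator add up to 1 and their absolute values to at most 7, so the
estimator is within 7 G of m ([bootstrap_estimator_empirical]), and its
expectation is within 7 N s of m ([risk_gap_bounds]): the estimators only grow
linearly in s.

All four claims therefore reduce to the size of the exponential moment
E[exp(alpha s xi)] of the standardized variable: the gap is
(1 / alpha) log E[exp(alpha s xi)], up to an error of at most 7 N s
([location_scale_gap_ge], [location_scale_gap_le]).
- The inequality E[exp(alpha s xi)] >= exp(alpha s y) Q(xi >= y) gives a lower
  bound s y + O(1) for each fixed y, so an unbounded right tail makes the gap
  superlinear.
- If Q(xi >= y) >= c exp(- k y^2), the choice y = alpha s / (2 k) gives a
  quadratic lower bound.
- For a Laplace variable and alpha s close to sqrt 2, each unit cell
  [k, k + 1[ contributes about the same amount to the exponential moment, and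
  the number of cells that do so grows without bound as alpha s tends to sqrt 2.
- Subgaussian tails give E[exp(alpha s xi)] <= C exp(c s^2), while
  exp(x) >= 1 + x gives E[exp(alpha s xi)] >= 1. *)

Set Implicit Arguments.
Unset Strict Implicit.
Unset Printing Implicit Defensive.

Local Open Scope classical_set_scope.
Local Open Scope ring_scope.

(** * Integrals of functions not known to be measurable *)

Section integral_bounds.
Context {d : measure_display} {T : measurableType d} {R : realType}.
Local Open Scope ereal_scope.

(** The integral is a difference of suprema over the simple functions below the
positive and negative parts, and each supremum is monotone.  Doing without
measurability spares a proof that the estimators are measurable functions of
the sample. *)
Lemma le_integralT (mu : {measure set T -> \bar R}) (f g : T -> \bar R) :
  (forall x, f x <= g x) -> \int[mu]_x f x <= \int[mu]_x g x.
Proof.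
have ge0_le (f1 f2 : T -> \bar R) : (forall x, 0 <= f1 x) ->
    (forall x, f1 x <= f2 x) -> \int[mu]_x f1 x <= \int[mu]_x f2 x.
  move=> f10 f12; rewrite !ge0_integralTE//; last first.
    by move=> x; exact: le_trans (f12 x).
  apply: ge_ereal_sup => _ [h hf <-]; apply: ereal_sup_ubound.
  by exists h => // x; exact: le_trans (f12 x).
move=> fg; rewrite integralE [leRHS]integralE; apply: leeB.
- apply: ge0_le => x; [exact: funepos_ge0|].
  by rewrite funepos.unlock ge_max !le_max fg lexx orbT.
- apply: ge0_le => x; [exact: funeneg_ge0|].
  by rewrite funeneg.unlock ge_max !le_max leeN2 fg lexx orbT.
Qed.

Lemma integral_cst_probability (mu : probability T R) (c : \bar R) :
  \int[mu]_x c = c.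
Proof.
by rewrite [LHS](integral_cst mu measurableT c)/= probability_setT mule1.
Qed.

(** Comparing [f] with [m - D] and [m + D] gives bounds centred at [m], which the
integral of [`|f|] would not. *)
Lemma integral_near_constant (mu : probability T R) (f : T -> \bar R)
    (D : T -> R) (m r : R) :
  measurable_fun setT D -> (forall x, 0 <= D x)%R ->
  \int[mu]_x (D x)%:E <= r%:E ->
  (forall x, (m - D x)%:E <= f x <= (m + D x)%:E) ->
  (m - r)%:E <= \int[mu]_x f x <= (m + r)%:E.
Proof.
move=> mD D0 Dr fD.
have iD : mu.-integrable setT (EFin \o D).
  apply/integrableP; split; first exact/measurable_EFinP.
  under eq_integral do rewrite /= ger0_norm//.
  exact: le_lt_trans Dr (ltry _).
have im : mu.-integrable setT (EFin \o cst m).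
  exact: finite_measure_integrable_cst.
have mE : \int[mu]_x (cst m x)%:E = m%:E.
  exact: (integral_cst_probability mu m%:E).
apply/andP; split.
- apply: (@le_trans _ _ (\int[mu]_x ((m - D x)%R)%:E)); last first.
    by apply: le_integralT => x; case/andP: (fD x).
  under eq_integral do rewrite EFinB.
  rewrite (@integralB_EFin _ _ _ mu setT (cst m) D measurableT)// mE EFinB.
  exact: leeB.
- apply: (@le_trans _ _ (\int[mu]_x ((m + D x)%R)%:E)).
    by apply: le_integralT => x; case/andP: (fD x).
  under eq_integral do rewrite EFinD.
  rewrite [leLHS](integralD_EFin measurableT im iD) [X in X + _]mE EFinD.
  exact: leeD2l.
Qed.

End integral_bounds.

(** * Integrals under i.i.d. and empirical laws *)

Section sampling.
Context {d : measure_display} {T : measurableType d} {R : realType}.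
Local Open Scope ereal_scope.

Lemma measurable_sum_tnth n (h : T -> \bar R) : measurable_fun setT h ->
  measurable_fun setT (fun y : n.-tuple T => \sum_(i < n) h (tnth y i)).
Proof.
move=> mh; apply: emeasurable_sum => i.
by apply: measurableT_comp mh _; exact: measurable_tnth.
Qed.

Lemma integral_iid_sum (Q : probability T R) n (h : T -> \bar R) :
  measurable_fun setT h -> (forall t, 0 <= h t) ->
  \int[iid_law Q n]_y (\sum_(i < n) h (tnth y i)) =
  n%:R%:E * \int[Q]_t h t.
Proof.
move=> mh h0; elim: n => [|n IH].
  under eq_integral do rewrite big_ord0.
  by rewrite integral0 mul0e.
have ms k : measurable_fun setT
    (fun y : k.-tuple T => \sum_(i < k) h (tnth y i)).
  exact: measurable_sum_tnth.
have s0 k (y : k.-tuple T) : 0 <= \sum_(i < k) h (tnth y i).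
  by apply: sume_ge0.
rewrite /= ge0_integral_distribution//; last 2 first.
- exact: ms.
- exact: s0.
under eq_integral => p _.
  rewrite /= big_ord_recl /= /tuple_cons (_ : tnth _ ord0 = p.1)//.
  under eq_bigr => i _ do rewrite tnthS.
  over.
rewrite /=.
rewrite ge0_integralD//=; last 3 first.
- exact: (measurableT_comp mh measurable_fst).
- by move=> x _; exact: s0.
- exact: (measurableT_comp (ms n) measurable_snd).
rewrite fubini_tonelli1//=; last exact: (measurableT_comp mh measurable_fst).
rewrite fubini_tonelli1//=; last 2 first.
- exact: (measurableT_comp (ms n) measurable_snd).
- by move=> x; exact: s0.
rewrite /fubini_F/=.
under eq_integral do rewrite integral_cst_probability.
under [X in _ + X]eq_integral do rewrite IH.
rewrite integral_cst_probability.
by rewrite -natr1 EFinD addeC ge0_muleDl// mul1e.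
Qed.

Lemma integral_empirical n (y : n.+1.-tuple T) (h : T -> \bar R) :
  measurable_fun setT h -> (forall t, 0 <= h t) ->
  \int[empirical y]_t h t =
  (n.+1%:R^-1)%:E * \sum_(i < n.+1) h (tnth y i).
Proof.
move=> mh h0.
rewrite ge0_integral_mscale//=; congr (_ * _).
rewrite ge0_integral_measure_sum//; apply: eq_bigr => i _.
by rewrite integral_dirac// diracT mul1e inord_val.
Qed.

(** Each of the n + 1 draws is uniform over the n + 1 entries of [y], so
resampling preserves the mean of every additive statistic. *)
Lemma integral_bootstrap_sum n (y : n.+1.-tuple T) (h : T -> \bar R) :
  measurable_fun setT h -> (forall t, 0 <= h t) ->
  \int[iid_law (empirical y) n.+1]_w (\sum_(i < n.+1) h (tnth w i)) =
  \sum_(i < n.+1) h (tnth y i).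
Proof.
move=> mh h0; rewrite integral_iid_sum// integral_empirical//.
by rewrite muleA -EFinM divff// mul1e.
Qed.

End sampling.

(** * The estimators are close to the mean loss *)

Section entropic_risk_bounds.
Context {d : measure_display} {T : measurableType d} {R : realType}.
Variables (alpha : R) (alpha_gt0 : 0 < alpha).
Local Open Scope ereal_scope.

Lemma entropic_risk_ge (Q : probability T R) (X : T -> R) (r : R) :
  (expR (alpha * r))%:E <= \int[Q]_t (expR (alpha * X t))%:E ->
  r%:E <= entropic_risk alpha Q X.
Proof.
rewrite /entropic_risk unlock => h.
rewrite -lee_pdivrMl ?invr_gt0// invrK -EFinM.
by rewrite -lee_expeR lneK// in_itv/= leey andbT integral_ge0.
Qed.

Lemma entropic_risk_le (Q : probability T R) (X : T -> R) (r : R) :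
  \int[Q]_t (expR (alpha * X t))%:E <= (expR (alpha * r))%:E ->
  entropic_risk alpha Q X <= r%:E.
Proof.
rewrite /entropic_risk unlock => h.
rewrite -lee_pdivlMl ?invr_gt0// invrK -EFinM.
by rewrite -lee_expeR lneK// in_itv/= leey andbT integral_ge0.
Qed.

Variables (X : T -> R) (mX : measurable_fun setT X) (m : R).

Definition dispersion n (y : n.-tuple T) : R :=
  (\sum_(i < n) `|X (tnth y i) - m|)%R.

Let mdev : measurable_fun setT (fun t => `|X t - m|%R%:E).
Proof.
apply/measurable_EFinP; apply: measurableT_comp => //.
exact: measurable_funB.
Qed.

Let dispersionE n (y : n.-tuple T) :
  (dispersion y)%:E = \sum_(i < n) `|X (tnth y i) - m|%R%:E.
Proof. by rewrite sumEFin. Qed.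

Lemma dispersion_ge0 n (y : n.-tuple T) : (0 <= dispersion y)%R.
Proof. exact: sumr_ge0. Qed.

Lemma measurable_dispersion n : measurable_fun setT (@dispersion n).
Proof.
apply/measurable_EFinP; rewrite [X in measurable_fun _ X](_ : _ =
  fun y => \sum_(i < n) `|X (tnth y i) - m|%R%:E); last first.
  by apply/funext => y; rewrite /= dispersionE.
exact: (measurable_sum_tnth mdev).
Qed.

Lemma integral_iid_dispersion (Q : probability T R) n :
  \int[iid_law Q n]_y (dispersion y)%:E =
  n%:R%:E * \int[Q]_t `|X t - m|%R%:E.
Proof.
under eq_integral do rewrite dispersionE.
exact: (integral_iid_sum Q n mdev).
Qed.

(** A log-mean-exp lies between the extreme values it averages, and each of these
is within the dispersion of [m]. *)
Lemma entropic_risk_empirical n (y : n.+1.-tuple T) :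
  (m - dispersion y)%:E <= entropic_risk alpha (empirical y) X
    <= (m + dispersion y)%:E.
Proof.
have mexp : measurable_fun setT (fun t => (expR (alpha * X t))%:E).
  apply/measurable_EFinP; apply: measurableT_comp => //.
  exact: measurable_funM.
have dev (i : 'I_n.+1) : (`|X (tnth y i) - m| <= dispersion y)%R.
  by rewrite /dispersion (bigD1 i)//= lerDl sumr_ge0.
have cstE (c : R) : c = (n.+1%:R^-1 * \sum_(i < n.+1) c)%R.
  by rewrite sumr_const card_ord -[(c *+ _)%R]mulr_natl mulKf.
apply/andP; split.
- apply: entropic_risk_ge; rewrite integral_empirical// sumEFin -EFinM lee_fin.
  rewrite [leLHS]cstE ler_wpM2l// ler_sum// => i _.
  rewrite ler_expR ler_pM2l//.
  by have := dev i; rewrite ler_norml => /andP[+ _]; lra.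
- apply: entropic_risk_le; rewrite integral_empirical// sumEFin -EFinM lee_fin.
  rewrite [leRHS]cstE ler_wpM2l// ler_sum// => i _.
  rewrite ler_expR ler_pM2l//.
  by have := dev i; rewrite ler_norml => /andP[_]; lra.
Qed.

(** A statistic that stays within the dispersion of the resample keeps, after
averaging, within the dispersion of the original sample; applied twice, this
covers the double bootstrap. *)
Let resample_preserves n (y : n.+1.-tuple T) (f : n.+1.-tuple T -> \bar R) :
  (forall w, (m - dispersion w)%:E <= f w <= (m + dispersion w)%:E) ->
  (m - dispersion y)%:E <= \int[iid_law (empirical y) n.+1]_w f w
    <= (m + dispersion y)%:E.
Proof.
apply: integral_near_constant; first exact: measurable_dispersion.
- by move=> w; exact: dispersion_ge0.
- under eq_integral do rewrite dispersionE.
  by rewrite (integral_bootstrap_sum y mdev)// dispersionE.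
Qed.

(** The coefficients 2 - 1 and 3 - 3 + 1 sum to 1, so [m] is reproduced; their
absolute values sum to 3 and to 7. *)
Lemma bootstrap_estimator_empirical (M : bootstrap_method) n
    (y : n.+1.-tuple T) :
  (m - 7 * dispersion y)%:E <= bootstrap_estimator M n alpha X (empirical y)
    <= (m + 7 * dispersion y)%:E.
Proof.
have E1 := entropic_risk_empirical y.
have E2 : (m - dispersion y)%:E <= resampled_risk n alpha X (empirical y)
    <= (m + dispersion y)%:E.
  exact: resample_preserves (@entropic_risk_empirical n).
have E3 : (m - dispersion y)%:E <= doubly_resampled_risk n alpha X (empirical y)
    <= (m + dispersion y)%:E.
  apply: resample_preserves => w.
  exact: resample_preserves (@entropic_risk_empirical n).
have D0 := dispersion_ge0 y.
have fin (x : \bar R) : (m - dispersion y)%:E <= x <= (m + dispersion y)%:E ->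
    exists2 a, x = a%:E & (m - dispersion y <= a <= m + dispersion y)%R.
  by case: x => [a| |] /andP[]//; rewrite !lee_fin => ? ?;
    exists a => //; apply/andP.
have [a Ea ha] := fin _ E1; have [b Eb hb] := fin _ E2.
have [c Ec hc] := fin _ E3.
case: M; rewrite /= ?Ea ?Eb ?Ec -?EFinM -?EFinN -?EFinD !lee_fin; lra.
Qed.

Lemma risk_gap_bounds (M : bootstrap_method) n (P : probability T R) (s : R) :
  \int[P]_t `|X t - m|%R%:E <= s%:E ->
  entropic_risk alpha P X - (m + 7 * n.+1%:R * s)%:E
    <= risk_gap M n alpha P X
    <= entropic_risk alpha P X - (m - 7 * n.+1%:R * s)%:E.
Proof.
move=> Xs; rewrite /risk_gap.
have : (m - 7 * n.+1%:R * s)%:E <=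
    \int[iid_law P n.+1]_x bootstrap_estimator M n alpha X (empirical x)
    <= (m + 7 * n.+1%:R * s)%:E.
  apply: (@integral_near_constant _ _ _ _ _ (fun y => 7 * dispersion y)%R).
  - by apply: measurable_funM => //; exact: measurable_dispersion.
  - by move=> y; rewrite mulr_ge0// dispersion_ge0.
  - under eq_integral do rewrite EFinM.
    rewrite ge0_integralZl_EFin//; last 2 first.
    + by move=> y _; rewrite lee_fin dispersion_ge0.
    + apply/measurable_EFinP. exact: measurable_dispersion.
    rewrite integral_iid_dispersion -mulrA EFinM lee_pmul2l// EFinM.
    by rewrite lee_pmul2l// lte_fin ltr0n.
  - by move=> y; exact: bootstrap_estimator_empirical.
by move=> /andP[h1 h2]; rewrite !leeB.
Qed.

End entropic_risk_bounds.

(** * Consequences of the location-scale relation *)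

Section transport.
Context {d d' : measure_display} {T : measurableType d} {U : measurableType d'}.
Context {R : realType}.
Local Open Scope ereal_scope.

(** The positive and the negative part of [f] have the same integral against the
common image measure, so the equality holds even where one of them is
infinite. *)
Lemma same_distribution_integral (P : probability T R) (X : T -> R)
    (Q : probability U R) (Y : U -> R) (f : R -> \bar R) :
  measurable_fun setT X -> measurable_fun setT Y -> measurable_fun setT f ->
  same_distribution P X Q Y ->
  \int[P]_t f (X t) = \int[Q]_u f (Y u).
Proof.
move=> mX mY mf XY.
have ge0E (g : R -> \bar R) : measurable_fun setT g -> (forall x, 0 <= g x) ->
    \int[P]_t g (X t) = \int[Q]_u g (Y u).
  move=> mg g0.
  rewrite -[LHS](@ge0_integral_pushforward _ _ _ _ _ X mX P setT g)//.
  rewrite -[RHS](@ge0_integral_pushforward _ _ _ _ _ Y mY Q setT g)//.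
  by apply: eq_measure_integral => B mB _; exact: XY.
rewrite integralE [RHS]integralE; congr (_ - _).
- have := ge0E _ (measurable_funepos mf) (funepos_ge0 f).
  by rewrite funepos.unlock.
- have := ge0E _ (measurable_funeneg mf) (funeneg_ge0 f).
  by rewrite funeneg.unlock.
Qed.

End transport.

Section standardized.
Context {dU : measure_display} {U : measurableType dU} {R : realType}.
Variables (Q : probability U R) (xi : {RV Q >-> R}).
Hypothesis xi_mean : ('E_Q[xi] = 0)%E.
Hypothesis xi_var : ('E_Q[fun w => (xi w ^+ 2)%R] = 1)%E.
Local Open Scope ereal_scope.

Let mxi : measurable_fun setT xi. Proof. exact: measurable_funPT. Qed.

Let mabs : measurable_fun setT (fun w => `|xi w|%R%:E).
Proof. by apply/measurable_EFinP; apply: measurableT_comp. Qed.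

Let msqr : measurable_fun setT (fun w => (xi w ^+ 2)%R%:E).
Proof. by apply/measurable_EFinP; exact: measurable_funX. Qed.

Lemma integral_sqr : \int[Q]_w (xi w ^+ 2)%R%:E = 1.
Proof. by move: xi_var; rewrite unlock. Qed.

(** From [|x| <= (1 + x^2) / 2]. *)
Lemma integral_abs_le1 : \int[Q]_w `|xi w|%R%:E <= 1.
Proof.
apply: (@le_trans _ _ (\int[Q]_w ((2^-1)%:E * (1 + (xi w ^+ 2)%R%:E)))).
  apply: le_integralT => w; rewrite -EFinD -EFinM lee_fin.
  have := sqr_ge0 (`|xi w| - 1)%R.
  rewrite sqrrB1 real_normK ?num_real// -mulr_natl; lra.
rewrite ge0_integralZl_EFin//; last 2 first.
- by move=> w _; rewrite -EFinD lee_fin addr_ge0// sqr_ge0.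
- exact: emeasurable_funD.
rewrite ge0_integralD//; last by move=> w _; rewrite lee_fin sqr_ge0.
rewrite integral_cst_probability integral_sqr -EFinD -EFinM lee_fin; lra.
Qed.

Lemma integrable_standardized : Q.-integrable setT (EFin \o xi).
Proof.
apply/integrableP; split; first exact/measurable_EFinP.
exact: le_lt_trans integral_abs_le1 (ltry _).
Qed.

Lemma integral_affine (m s : R) : \int[Q]_w (m + s * xi w)%R%:E = m%:E.
Proof.
under eq_integral do rewrite EFinD EFinM.
rewrite integralD//; last 2 first.
- exact: finite_measure_integrable_cst.
- exact: (integrableZl measurableT s integrable_standardized).
rewrite integral_cst_probability.
rewrite (integralZl measurableT integrable_standardized).
by move: xi_mean; rewrite unlock => ->; rewrite mule0 adde0.
Qed.

Context {d : measure_display} {T : measurableType d}.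
Variables (P : probability T R) (X : T -> R) (mX : measurable_fun setT X).
Variables (m s : R).
Hypothesis s_ge0 : (0 <= s)%R.
Hypothesis XE : same_distribution P X Q (fun w => m + s * xi w)%R.

Let maff : measurable_fun setT (fun w => m + s * xi w)%R.
Proof. by apply: measurable_funD => //; exact: measurable_funM. Qed.

Lemma location_scale_integral (f : R -> \bar R) : measurable_fun setT f ->
  \int[P]_t f (X t) = \int[Q]_w f (m + s * xi w)%R.
Proof. by move=> mf; exact: same_distribution_integral. Qed.

Lemma location_scale_mean : 'E_P[X] = m%:E.
Proof.
rewrite unlock (@location_scale_integral EFin) ?integral_affine//.
Qed.

Lemma location_scale_variance : 'V_P[X] = (s ^+ 2)%:E.
Proof.
rewrite /variance covariance.unlock location_scale_mean/= unlock.
under eq_integral do rewrite /= -expr2.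
rewrite (@location_scale_integral (fun x => ((x - m) ^+ 2)%R%:E)); last first.
  by apply/measurable_EFinP; apply: measurable_funX; exact: measurable_funB.
under eq_integral do rewrite [(m + _)%R]addrC addrK exprMn EFinM.
rewrite ge0_integralZl_EFin//= ?integral_sqr ?mule1 ?sqr_ge0//.
by move=> w _; rewrite lee_fin sqr_ge0.
Qed.

Lemma location_scale_std_dev : std_dev P X = s.
Proof. by rewrite /std_dev location_scale_variance/= sqrtr_sqr ger0_norm. Qed.

Lemma location_scale_abs_dev : \int[P]_t `|X t - m|%R%:E <= s%:E.
Proof.
rewrite (@location_scale_integral (fun x => `|x - m|%R%:E)); last first.
  apply/measurable_EFinP; apply: measurableT_comp => //.
  exact: measurable_funB.
under eq_integral do rewrite [(m + _)%R]addrC addrK normrM ger0_norm// EFinM.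
rewrite ge0_integralZl_EFin// -[leRHS]mule1.
by rewrite lee_wpmul2l ?lee_fin// integral_abs_le1.
Qed.

Variables (alpha : R) (alpha_gt0 : (0 < alpha)%R) (M : bootstrap_method).
Variable n : nat.

Let exp_momentE : \int[P]_t (expR (alpha * X t))%:E =
  (expR (alpha * m))%:E * \int[Q]_w (expR (alpha * s * xi w))%:E.
Proof.
have mexp (c : R) : measurable_fun setT (fun x : R => (expR (c * x))%:E).
  apply/measurable_EFinP; apply: measurableT_comp => //.
rewrite (@location_scale_integral (fun x => (expR (alpha * x))%:E))//.
under eq_integral do rewrite mulrDr expRD EFinM mulrA.
rewrite ge0_integralZl_EFin// ?expR_ge0//.
exact: (measurableT_comp (mexp _) mxi).
Qed.

(** Shifting the loss by [m] shifts both the true risk and the estimator by [m],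
so only the exponential moment of [s * xi] matters. *)
Lemma location_scale_gap_ge (r : R) :
  (expR (alpha * r))%:E <= \int[Q]_w (expR (alpha * s * xi w))%:E ->
  (r - 7 * n.+1%:R * s)%:E <= risk_gap M n alpha P X.
Proof.
move=> h; have /andP[+ _] :=
  risk_gap_bounds alpha_gt0 mX M n location_scale_abs_dev.
apply: le_trans.
have : (m + r)%:E <= entropic_risk alpha P X.
  apply: entropic_risk_ge => //.
  by rewrite exp_momentE mulrDr expRD EFinM lee_pmul2l// lte_fin expR_gt0.
move=> H; apply: (le_trans _ (leeB H (lexx (m + 7 * n.+1%:R * s)%:E))).
by rewrite -EFinB lee_fin; lra.
Qed.

Lemma location_scale_gap_le (r : R) :
  \int[Q]_w (expR (alpha * s * xi w))%:E <= (expR (alpha * r))%:E ->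
  risk_gap M n alpha P X <= (r + 7 * n.+1%:R * s)%:E.
Proof.
move=> h; have /andP[_] :=
  risk_gap_bounds alpha_gt0 mX M n location_scale_abs_dev.
move=> /le_trans; apply.
have : entropic_risk alpha P X <= (m + r)%:E.
  apply: entropic_risk_le => //.
  by rewrite exp_momentE mulrDr expRD EFinM lee_pmul2l// lte_fin expR_gt0.
move=> H; apply: (le_trans (leeB H (lexx (m - 7 * n.+1%:R * s)%:E))).
by rewrite -EFinB lee_fin; lra.
Qed.

End standardized.

(** * Bounds on integrals by layers *)

Section layers.
Context {d : measure_display} {T : measurableType d} {R : realType}.
Variables (mu : {measure set T -> \bar R}) (c : nat -> R) (B : nat -> set T).
Hypotheses (c_ge0 : forall k, 0 <= c k) (mB : forall k, measurable (B k)).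
Local Open Scope ereal_scope.

Let integral_layer k :
  \int[mu]_t ((c k * \1_(B k) t)%R)%:E = (c k)%:E * mu (B k).
Proof.
under eq_integral do rewrite EFinM.
rewrite ge0_integralZl_EFin//; first by rewrite integral_indic// setIT.
by apply/measurable_EFinP; exact: measurable_indic.
Qed.

Let mlayer k : measurable_fun setT (fun t => ((c k * \1_(B k) t)%R)%:E).
Proof.
by apply/measurable_EFinP; apply: measurable_funM.
Qed.

Let layer_ge0 k t : (0 <= c k * \1_(B k) t :> R)%R.
Proof. by rewrite mulr_ge0. Qed.

Lemma integral_ge_layers (L : nat) (f : T -> R) :
  (forall t, \sum_(k < L) c k * \1_(B k) t <= f t)%R ->
  \sum_(k < L) (c k)%:E * mu (B k) <= \int[mu]_t (f t)%:E.
Proof.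
move=> hf; under eq_bigr do rewrite -integral_layer.
rewrite -ge0_integral_sum//; last by move=> i t _; rewrite lee_fin.
by apply: le_integralT => t; rewrite sumEFin lee_fin.
Qed.

(** Some single layer dominating [f] at each point suffices, since all the layers
are nonnegative. *)
Lemma integral_le_layers (f : T -> R) :
  (forall t, exists k, (f t <= c k * \1_(B k) t)%R) ->
  \int[mu]_t (f t)%:E <= \sum_(k <oo) (c k)%:E * mu (B k).
Proof.
move=> hf; under eq_eseriesr do rewrite -integral_layer.
rewrite -integral_nneseries//; last by move=> i t _; rewrite lee_fin.
apply: le_integralT => t; have [k hk] := hf t.
apply: (@le_trans _ _ (\sum_(0 <= i < k.+1) ((c i * \1_(B i) t)%R)%:E)).
  rewrite big_nat_recr//= -[leLHS]add0e leeD// ?lee_fin//.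
  by apply: sume_ge0 => i _; rewrite lee_fin.
by apply: nneseries_lim_ge => i _ _; rewrite lee_fin.
Qed.

End layers.

Lemma integral_itv_ge (R : realType) (u v c : R) (g : R -> R) :
  u <= v -> (forall x, u <= x < v -> c <= g x) ->
  ((c * (v - u))%:E <=
    \int[lebesgue_measure]_(x in `[u, v[%classic) (g x)%:E)%E.
Proof.
move=> uv cg.
have -> : (c * (v - u))%:E =
    (\int[@lebesgue_measure R]_(x in `[u, v[%classic) (cst c x)%:E)%E.
  rewrite [RHS](integral_cst _ _ c%:E)//= lebesgue_measure_itv/= lte_fin.
  by case: ltgtP uv => // -> _; rewrite subrr mule0 mulr0.
rewrite integral_mkcond [leRHS]integral_mkcond; apply: le_integralT => x.
rewrite /patch; case: ifPn => // /set_mem/=; rewrite in_itv/= => hx.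
by rewrite lee_fin cg.
Qed.

(** * Exponential moments from tail probabilities *)

Section exponential_moment.
Context {dU : measure_display} {U : measurableType dU} {R : realType}.
Variables (Q : probability U R) (xi : {RV Q >-> R}).
Local Open Scope ereal_scope.

Lemma measurable_right_tail (y : R) : measurable [set w | (y <= xi w)%R].
Proof.
rewrite (_ : [set w | _] = xi @^-1` `[y, +oo[%classic).
  by rewrite -[X in measurable X]setTI; exact: measurable_funPT.
by apply/seteqP; split => w /=; rewrite in_itv/= andbT.
Qed.

Lemma measurable_abs_tail (y : R) : measurable [set w | (y <= `|xi w|)%R].
Proof.
rewrite (_ : [set w | _] = (Num.norm \o xi) @^-1` `[y, +oo[%classic).
  rewrite -[X in measurable X]setTI.
  have mabs : measurable_fun setT (Num.norm \o xi) by exact: measurableT_comp.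
  exact: mabs.
by apply/seteqP; split => w /=; rewrite in_itv/= andbT.
Qed.

(** Markov's inequality for [expR (lambda * xi)], read as a lower bound on the
exponential moment. *)
Lemma exp_moment_ge_tail (lambda y : R) : (0 <= lambda)%R ->
  (expR (lambda * y))%:E * Q [set w | (y <= xi w)%R] <=
  \int[Q]_w (expR (lambda * xi w))%:E.
Proof.
move=> l0.
have := @integral_ge_layers _ _ _ Q (fun=> expR (lambda * y))
  (fun=> [set w | (y <= xi w)%R]) (fun=> expR_ge0 _)
  (fun=> measurable_right_tail y) 1 (fun w => expR (lambda * xi w)).
rewrite big_ord1; apply => w; rewrite big_ord1 indicE.
case: (boolP (w \in _)) => [/set_mem/= yw|_].
  by rewrite mulr1 ler_expR ler_wpM2l.
by rewrite mulr0 expR_ge0.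
Qed.

(** On the cell [[k, k + 1[] the exponential is at least [expR (lambda * k)], and
at most one cell contains a given value. *)
Lemma exp_moment_ge_unit_cells (lambda : R) (p : nat -> R) (L : nat) :
  (0 <= lambda)%R ->
  (forall k : nat, (p k)%:E <= Q (xi @^-1` `[k%:R, (k%:R + 1)%R[%classic)) ->
  (\sum_(k < L) expR (lambda * k%:R) * p k)%R%:E <=
  \int[Q]_w (expR (lambda * xi w))%:E.
Proof.
move=> l0 hp; pose B (k : nat) := xi @^-1` `[k%:R, (k%:R + 1)%R[%classic.
have mB k : measurable (B k).
  by rewrite -[B k]setTI; exact: measurable_funPT.
apply: (@le_trans _ _ (\sum_(k < L) (expR (lambda * k%:R))%:E * Q (B k))).
  rewrite -sumEFin; apply: lee_sum => k _; rewrite EFinM.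
  by rewrite lee_pmul2l// lte_fin expR_gt0.
have c0 (k : nat) : (0 <= expR (lambda * k%:R))%R by exact: expR_ge0.
apply: (integral_ge_layers Q c0 mB) => w.
have [|] : (xi w < L%:R)%R \/ (L%:R <= xi w)%R by case: ltP; [left|right].
- move=> _.
  (* At most one indicator, that of the cell [j] of [xi w], is nonzero. *)
  have [/existsP[j jw]|/existsPn nw] := boolP [exists j : 'I_L, w \in B j].
  + rewrite (bigD1 j)//= big1 => [|i ij].
      rewrite addr0 indicE jw mulr1 ler_expR ler_wpM2l//.
      by move/set_mem: jw; rewrite /B/= in_itv/= => /andP[].
    rewrite indicE; case: (boolP (w \in B i)) => [iw|_]; last by rewrite mulr0.
    move: iw jw => /set_mem + /set_mem.
    rewrite /B/= !in_itv/= !natr1 => /andP[i1 i2] /andP[j1 j2].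
    have : (i < j.+1)%N by rewrite -(ltr_nat R); exact: le_lt_trans j2.
    have : (j < i.+1)%N by rewrite -(ltr_nat R); exact: le_lt_trans i2.
    rewrite !ltnS => ji ij'; case/eqP: ij; apply/val_inj/eqP.
    by rewrite eqn_leq ij' ji.
  + rewrite big1 ?expR_ge0// => i _.
    by rewrite indicE (negbTE (nw i)) mulr0.
- move=> Lw; rewrite big1 ?expR_ge0// => i _.
  rewrite indicE; case: (boolP (w \in B i)) => [|_]; last by rewrite mulr0.
  move/set_mem; rewrite /B/= in_itv/= natr1 => /andP[_ /(le_lt_trans Lw)].
  by rewrite ltr_nat ltnS leqNgt ltn_ord.
Qed.

(** Young's inequality
[lambda x <= lambda^2 / (2 kappa) + kappa x^2 / 2] leaves the exponential of
[v = kappa xi^2 / 2], whose integer layers [k <= v] have weight [e^(k + 1)] and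
probability at most [b e^(- 2 k)]: a convergent geometric series. *)
Lemma exp_moment_le_subgaussian (b kappa lambda : R) :
  (0 < kappa)%R -> (0 <= b)%R ->
  (forall a : R, (0 <= a)%R ->
    Q [set w | (a <= `|xi w|)%R] <= (b * expR (- (kappa * a ^+ 2)))%:E) ->
  \int[Q]_w (expR (lambda * xi w))%:E <=
  (expR (lambda ^+ 2 / (2 * kappa)) * (expR 1 * b * 2))%:E.
Proof.
move=> k0 b0 tail.
(* [a k <= `|x|] says exactly that [k <= kappa * x ^+ 2 / 2]. *)
pose a (k : nat) : R := Num.sqrt (2 * k%:R / kappa).
pose l2 : R := (lambda ^+ 2 / (2 * kappa))%R.
pose c (k : nat) : R := (expR l2 * expR (k.+1)%:R)%R.
have c0 k : (0 <= c k)%R by rewrite mulr_ge0 ?expR_ge0.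
have aE k : (kappa * a k ^+ 2 = 2 * k%:R)%R.
  rewrite sqr_sqrtr; first by field; rewrite gt_eqF.
  by rewrite divr_ge0 ?mulr_ge0// ltW.
apply: le_trans (_ : \sum_(k <oo) (c k)%:E * Q [set w | (a k <= `|xi w|)%R]
    <= _).
  apply: integral_le_layers => // [k|w]; first exact: measurable_abs_tail.
  pose v : R := (kappa / 2 * xi w ^+ 2)%R.
  have v0 : (0 <= v)%R by rewrite mulr_ge0 ?sqr_ge0// divr_ge0// ltW.
  exists (Num.truncn v).
  have /andP[kv vk] := truncn_itv v0.
  rewrite indicE mem_set/= ?mulr1; last first.
    rewrite -(@ler_pXn2r _ 2)// ?nnegrE ?sqrtr_ge0//.
    rewrite -(ler_pM2l k0) aE real_normK ?num_real//.
    by move: kv; rewrite /v; lra.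
  rewrite /c -expRD ler_expR.
  apply: (@le_trans _ _ (l2 + v)%R); last by rewrite lerD2l ltW.
  rewrite /l2 /v -subr_ge0.
  have -> : (lambda ^+ 2 / (2 * kappa) + kappa / 2 * xi w ^+ 2 - lambda * xi w
      = (lambda - kappa * xi w) ^+ 2 / (2 * kappa))%R.
    by field; rewrite gt_eqF.
  by rewrite divr_ge0 ?sqr_ge0// mulr_ge0// ltW.
(* As [expR 1 >= 2], the series is compared with that of the powers of 1/2. *)
have half k : (expR (- k%:R) <= 2^-1 ^+ k :> R)%R.
  rewrite expRN -[k%:R]mulr1 expRM_natl -exprVn.
  rewrite lerXn2r ?nnegrE ?invr_ge0 ?expR_ge0//.
  rewrite lef_pV2 ?posrE ?expR_gt0//.
  by have := @expR_ge1Dx R 1; lra.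
have term k : (c k)%:E * Q [set w | (a k <= `|xi w|)%R] <=
    (expR l2 * (expR 1 * b) * 2^-1 ^+ k)%:E.
  apply: (@le_trans _ _ ((c k)%:E * (b * expR (- (kappa * a k ^+ 2)))%:E)).
    by rewrite lee_wpmul2l ?lee_fin// tail// sqrtr_ge0.
  rewrite aE -EFinM lee_fin /c.
  have -> : (expR l2 * expR k.+1%:R * (b * expR (- (2 * k%:R))) =
      expR l2 * (expR 1 * b) * expR (- k%:R))%R.
    rewrite -natr1 (_ : - (2 * k%:R) = - k%:R - k%:R :> R)%R; last by ring.
    rewrite !expRD; have := @expRxMexpNx_1 R k%:R => h.
    transitivity (expR l2 * (expR 1 * b) * expR (- k%:R) *
      (expR k%:R * expR (- k%:R)))%R; first by ring.
    by rewrite h mulr1.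
  by rewrite ler_wpM2l// !mulr_ge0 ?expR_ge0.
apply: lime_le.
  by apply: is_cvg_nneseries => k _ _; rewrite mule_ge0// lee_fin.
apply: nearW => N.
apply: le_trans (lee_sum _ (fun k _ => term k)) _.
rewrite sumEFin lee_fin -mulr_sumr [leRHS]mulrA ler_wpM2l//.
  by rewrite !mulr_ge0 ?expR_ge0.
have := @geometric_le_lim R N 1 2^-1.
rewrite seriesEnat /geometric/= (_ : 1 / (1 - 2^-1) = 2 :> R)%R; last by field.
under eq_bigr do rewrite mul1r.
by apply => //; rewrite ger0_norm; lra.
Qed.

End exponential_moment.

(** * Laplace, normal and subgaussian laws *)

Section laws.
Context {dU : measure_display} {U : measurableType dU} {R : realType}.
Variables (Q : probability U R) (xi : {RV Q >-> R}).

(** When [lambda] is within [1 / L] of [Num.sqrt 2], the decay of the density and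
the growth of the exponential cancel on the first [L] unit cells up to a
factor [e], so each cell contributes at least a fixed amount. *)
Lemma laplace_exp_moment_ge (lambda : R) (L : nat) :
  laplace_distributed Q xi -> 0 <= lambda ->
  `|lambda - Num.sqrt 2| * L%:R <= 1 ->
  ((L%:R * ((Num.sqrt 2)^-1 * expR (- (Num.sqrt 2 + 1))))%:E <=
    \int[Q]_w (expR (lambda * xi w))%:E)%E.
Proof.
move=> lap l0 lL; set q : R := Num.sqrt 2.
have q0 : 0 < q by rewrite sqrtr_gt0.
pose p (k : nat) : R := q^-1 * expR (- (q * (k%:R + 1))).
apply: le_trans (@exp_moment_ge_unit_cells _ _ _ Q xi lambda p L l0 _).
  rewrite lee_fin mulr_natl -[L in _ *+ L]card_ord -sumr_const ler_sum// => k _.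
  rewrite /p mulrCA ler_wpM2l ?invr_ge0 ?(ltW q0)// -expRD ler_expR.
  suff : - 1 <= (lambda - q) * k%:R by lra.
  have := ler_norm (- ((lambda - q) * k%:R)).
  rewrite normrN normrM [`|k%:R|]ger0_norm// => h.
  have : `|lambda - q| * k%:R <= `|lambda - q| * L%:R.
    by rewrite ler_wpM2l// ler_nat ltnW.
  by move: lL; rewrite -/q; lra.
move=> k; rewrite lap//.
apply: le_trans (integral_itv_ge (c := p k) _ _).
- by rewrite [k%:R + 1]addrC addrK mulr1.
- by rewrite lerDl.
- move=> x /andP[kx xk]; rewrite /p -/q ler_wpM2l ?invr_ge0 ?(ltW q0)//.
  rewrite ler_expR lerN2 ler_wpM2l ?(ltW q0)// ger0_norm ?(ltW xk)//.
  exact: le_trans kx.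
Qed.


End laws.

Lemma normal_prob_itv_ge (R : realType) (a b u v r : R) : b != 0 -> u <= v ->
  (forall x, u <= x < v -> `|x - a| <= r) ->
  ((normal_peak b * expR (- (r ^+ 2 / (2 * b ^+ 2))) * (v - u))%:E <=
    normal_prob a b `[u, v[%classic)%E.
Proof.
move=> b0 uv ur; apply: integral_itv_ge => // x /ur xr.
rewrite /normal_pdf (negbTE b0) ler_wpM2l ?normal_peak_ge0//.
rewrite /normal_fun ler_expR mulNr lerN2 -[b ^+ 2 *+ 2]mulr_natl.
rewrite ler_pM2r; last by rewrite invr_gt0 mulr_gt0// exprn_even_gt0.
rewrite -[(x - a) ^+ 2]real_normK ?num_real//.
by rewrite lerXn2r ?nnegrE// (le_trans _ xr).
Qed.

Section tails.
Context {dU : measure_display} {U : measurableType dU} {R : realType}.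
Variables (Q : probability U R) (xi : {RV Q >-> R}).
Context {d : measure_display} {T : measurableType d}.
Variables (P : probability T R) (X : T -> R) (mX : measurable_fun setT X).
Variables (m s : R) (s_gt0 : 0 < s).
Hypothesis xi_mean : ('E_Q[xi] = 0)%E.
Hypothesis xi_var : ('E_Q[fun w => (xi w ^+ 2)%R] = 1)%E.
Hypothesis XE : same_distribution P X Q (fun w => m + s * xi w).

(** A Dirac law has variance 0, not [s ^+ 2]. *)
Lemma location_scale_not_dirac (a : R) :
  ~ same_distribution P X (\d_a : probability _ R) id.
Proof.
move=> XD.
have mid : measurable_fun [set: R] (@id R) by exact: measurable_id.
have VX := location_scale_variance xi_mean xi_var mX XE.
have EX := location_scale_mean xi_mean xi_var mX XE.
have am : a = m.
  move: EX; rewrite unlock.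
  rewrite (same_distribution_integral (f := EFin) mX mid _ XD)//.
  by rewrite integral_dirac// diracT mul1e => -[].
have mf : measurable_fun setT (fun x : R => ((x - m) ^+ 2)%:E).
  by apply/measurable_EFinP; apply: measurable_funX; exact: measurable_funB.
move: VX; rewrite /variance covariance.unlock EX/= unlock.
under eq_integral do rewrite /= -expr2.
rewrite (same_distribution_integral mX mid mf XD).
rewrite integral_dirac// diracT mul1e am subrr expr0n/= => -[] /esym/eqP.
by rewrite sqrf_eq0 gt_eqF.
Qed.

(** The unit cell [[y, y + 1[] alone gives the order of decay of the tail: when
[xi] lies in it, [X] is within [e + s y] of the centre [a] of its density, and
[(e + s y)^2 <= 2 e^2 + 2 (s y)^2] separates the constant from [y]. *)
Lemma normal_right_tail_ge : normally_distributed P X ->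
  exists c k : R, [/\ 0 < c, 0 < k & forall y : R, 0 <= y ->
    ((c * expR (- (k * y ^+ 2)))%:E <= Q [set w | (y <= xi w)%R])%E].
Proof.
move=> [a [b [b0 XN]]].
have bN0 : b != 0.
  apply/eqP => b_eq0; apply: (@location_scale_not_dirac a) => B mB.
  by rewrite XN// b_eq0 eqxx.
have b2 : 0 < b ^+ 2 by rewrite exprn_even_gt0.
pose e : R := `|m - a| + s.
exists (normal_peak b * expR (- (e ^+ 2 / b ^+ 2)) * s), (s ^+ 2 / b ^+ 2).
split.
- by rewrite !mulr_gt0 ?normal_peak_gt0 ?expR_gt0.
- by rewrite divr_gt0// exprn_gt0.
move=> y y0.
pose I : set R := `[(m + s * y)%R, (m + s * (y + 1))%R[%classic.
have mI : measurable I by exact: measurable_itv.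
apply: (@le_trans _ _ (Q ((fun w => m + s * xi w) @^-1` I))); last first.
  have maff : measurable_fun setT (fun w => m + s * xi w).
    by apply: measurable_funD => //; exact: measurable_funM.
  apply: le_measure; rewrite ?inE.
  - by rewrite -[X in measurable X]setTI; exact: maff.
  - exact: measurable_right_tail.
  - move=> w /=; rewrite /I/= in_itv/= => /andP[+ _].
    by rewrite lerD2l ler_pM2l.
rewrite -XE// XN// (negbTE bN0).
have sy : 0 <= s * y by rewrite mulr_ge0// ltW.
apply: le_trans (normal_prob_itv_ge (r := e + s * y) bN0 _ _); last 2 first.
- by rewrite lerD2l ler_pM2l// lerDl.
- move=> x /andP[x1 x2]; rewrite (_ : x - a = (m - a) + (x - m)); last by ring.
  apply: le_trans (ler_normD _ _) _; rewrite /e -addrA lerD2l.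
  by rewrite ger0_norm; lra.
have -> : m + s * (y + 1) - (m + s * y) = s by ring.
rewrite lee_fin mulrAC ler_pM2r// -[leLHS]mulrA -expRD.
rewrite ler_wpM2l ?normal_peak_ge0// ler_expR -subr_ge0.
rewrite (_ : _ - _ = (e - s * y) ^+ 2 / (2 * b ^+ 2)); last first.
  by field; rewrite bN0.
by rewrite divr_ge0 ?sqr_ge0 ?mulr_ge0 ?(ltW b2).
Qed.

(** Passing from [X] to [xi] shifts the level by [|m|].  Below [|m|] the bound
exceeds 1; above it, [(s a - |m|)^2 >= (s a)^2 / 2 - m^2]. *)
Lemma subgaussian_standardized : subgaussian_tails P X ->
  exists b kappa : R, [/\ 0 < b, 0 < kappa & forall a : R, 0 <= a ->
    (Q [set w | (a <= `|xi w|)%R] <= (b * expR (- (kappa * a ^+ 2)))%:E)%E].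
Proof.
move=> [c0 c0_gt0 tail].
have c2 : 0 < c0 ^+ 2 by rewrite exprn_gt0.
exists (2 * expR (m ^+ 2 / c0 ^+ 2)), (s ^+ 2 / (2 * c0 ^+ 2)).
split; [by rewrite mulr_gt0 ?expR_gt0| |].
  by rewrite divr_gt0 ?mulr_gt0 ?exprn_gt0.
move=> a a0; rewrite -mulrA -expRD.
have [am|ma] := leP (s * a) `|m|.
  apply: (@le_trans _ _ 1%E).
    by apply: probability_le1; exact: measurable_abs_tail.
  rewrite lee_fin.
  have : 1 + (m ^+ 2 / c0 ^+ 2 - s ^+ 2 / (2 * c0 ^+ 2) * a ^+ 2) <=
    expR (m ^+ 2 / c0 ^+ 2 - s ^+ 2 / (2 * c0 ^+ 2) * a ^+ 2).
    exact: expR_ge1Dx.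
  suff : 0 <= m ^+ 2 / c0 ^+ 2 - s ^+ 2 / (2 * c0 ^+ 2) * a ^+ 2 by lra.
  rewrite (_ : _ - _ = (m ^+ 2 - 2^-1 * (s * a) ^+ 2) / c0 ^+ 2); last first.
    by field; rewrite gt_eqF.
  rewrite divr_ge0 ?(ltW c2)//.
  have : (s * a) ^+ 2 <= `|m| ^+ 2.
    by rewrite lerXn2r ?nnegrE// mulr_ge0// ltW.
  rewrite real_normK ?num_real//.
  have := sqr_ge0 (s * a); lra.
have r0 : 0 <= s * a - `|m| by rewrite subr_ge0 ltW.
have mB : measurable [set x : R | s * a - `|m| <= `|x|].
  have mn : measurable_fun setT (fun x : R => `|x|) by exact: measurableT_comp.
  have := mn measurableT `[s * a - `|m|, +oo[%classic (measurable_itv _).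
  by rewrite setTI set_itvE.
apply: (@le_trans _ _ (P [set t | s * a - `|m| <= `|X t| ])).
  have -> : P [set t | s * a - `|m| <= `|X t| ] =
      Q ((fun w => m + s * xi w) @^-1` [set x : R | s * a - `|m| <= `|x|]).
    exact: XE.
  have maff : measurable_fun setT (fun w => m + s * xi w).
    by apply: measurable_funD => //; exact: measurable_funM.
  apply: le_measure; rewrite ?inE.
  - exact: measurable_abs_tail.
  - by rewrite -[X in measurable X]setTI; exact: maff.
  - move=> w /= aw.
    have sa : s * a <= s * `|xi w| by rewrite ler_pM2l.
    have := ler_normB (m + s * xi w) m.
    rewrite [m + _]addrC addrK normrM (gtr0_norm s_gt0); lra.
apply: le_trans (tail _ r0) _; rewrite lee_fin ler_pM2l// ler_expR.
rewrite -subr_ge0 -[m ^+ 2]real_normK ?num_real//.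
rewrite (_ : _ - _ = (s * a - 2 * `|m|) ^+ 2 / (2 * c0 ^+ 2)); last first.
  by field; rewrite gt_eqF.
by rewrite divr_ge0 ?sqr_ge0// mulr_ge0// ltW.
Qed.

End tails.

(** * Growth of the gap *)

Section regimes.
Context {D : Type} {d d' : measure_display}.
Context {T : measurableType d} {U : measurableType d'} {R : realType}.
Variables (alpha : R) (alpha_gt0 : 0 < alpha) (n : nat) (M : bootstrap_method).
Variables (Z : set D) (P : probability T R) (ell : D -> T -> R).
Hypothesis ell_meas : forall z, Z z -> measurable_fun setT (ell z).
Variables (Q : probability U R) (xi : {RV Q >-> R}) (A : set (R * R)).
Hypothesis hLS : location_scale Z P ell Q xi A.

Let gap z := risk_gap M n alpha P (ell z).
Let sigma z := std_dev P (ell z).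
Let N : R := 7 * n.+1%:R.

Let N_gt0 : 0 < N. Proof. by rewrite mulr_gt0. Qed.

Lemma location_scale_decision z : Z z -> exists m s : R, [/\ 0 <= s,
  same_distribution P (ell z) Q (fun w => m + s * xi w),
  sigma z = s & fine 'V_P[ell z] = s ^+ 2].
Proof.
case: hLS => xi_mean xi_var A_ge0 ZA _ zZ.
have [[m s] /A_ge0/= s0 XE] := ZA z zZ; exists m, s.
have mX := ell_meas zZ; split => //.
- exact: (location_scale_std_dev xi_mean xi_var mX s0 XE).
- by rewrite (location_scale_variance xi_mean xi_var mX XE).
Qed.

Lemma gap_ge_of_exp_moment z r : Z z ->
  ((expR (alpha * r))%:E <= \int[Q]_w (expR (alpha * sigma z * xi w))%:E)%E ->
  ((r - N * sigma z)%:E <= gap z)%E.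
Proof.
move=> zZ; have [m [s [s0 XE -> _]]] := location_scale_decision zZ.
case: hLS => xi_mean xi_var _ _ _.
exact: (location_scale_gap_ge xi_var (ell_meas zZ) s0 XE alpha_gt0 M).
Qed.

Lemma gap_le_of_exp_moment z r : Z z ->
  (\int[Q]_w (expR (alpha * sigma z * xi w))%:E <= (expR (alpha * r))%:E)%E ->
  (gap z <= (r + N * sigma z)%:E)%E.
Proof.
move=> zZ; have [m [s [s0 XE -> _]]] := location_scale_decision zZ.
case: hLS => xi_mean xi_var _ _ _.
exact: (location_scale_gap_le xi_var (ell_meas zZ) s0 XE alpha_gt0 M).
Qed.

(** The bound behind the first two growth rates: [y] is constant for an unbounded
tail and proportional to [sigma z] for a normal law. *)
Lemma gap_ge_of_tail z (y q : R) : Z z -> 0 < q ->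
  (q%:E <= Q [set w | (y <= xi w)%R])%E ->
  ((sigma z * y + ln q / alpha - N * sigma z)%:E <= gap z)%E.
Proof.
move=> zZ q0 hq; apply: gap_ge_of_exp_moment => //.
have s0 : 0 <= sigma z by exact: sqrtr_ge0.
apply: le_trans (exp_moment_ge_tail _ y _); last by rewrite mulr_ge0// ltW.
have -> : alpha * (sigma z * y + ln q / alpha) = alpha * sigma z * y + ln q.
  by field; rewrite gt_eqF.
by rewrite expRD lnK ?posrE// EFinM lee_pmul2l// lte_fin expR_gt0.
Qed.

Lemma gap_superlinear_of_unbounded_tail : unbounded_right_tail Q xi ->
  is_smallomega Z sigma gap (fun s => s).
Proof.
move=> ub c c0; have /= := ub (c + N + 1).
set p := Q _ => p0.
have pfin : p \is a fin_num.
  by rewrite /p fin_num_measure//; exact: measurable_right_tail.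
pose q : R := fine p.
have q0 : 0 < q by rewrite fine_gt0// p0 ltey_eq pfin.
(* At y = c + N + 1 the spare unit of slope absorbs [ln q / alpha]. *)
exists (`|ln q / alpha| + 1) => [|z zZ sz]; first by rewrite ltr_wpDl.
apply: le_trans (gap_ge_of_tail zZ q0 (y := c + N + 1) _); last first.
  by rewrite fineK.
rewrite lee_fin; have := ler_norm (- (ln q / alpha)); rewrite normrN; lra.
Qed.

(** Any single decision with positive variance transfers normality to [xi],
giving tail constants common to all decisions. *)
Lemma gap_quadratic_of_normal :
  (forall z, Z z -> normally_distributed P (ell z)) ->
  is_bigOmega Z sigma gap (fun s => s ^+ 2).
Proof.
move=> normal; have [[z0 [z0Z s0]]|none] :=
  pselect (exists z, Z z /\ 0 < sigma z); last first.
  exists 1, 1; split => // z zZ sz; exfalso; apply: none; exists z; split => //.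
  exact: lt_le_trans sz.
have [m [s [_ XE sE _]]] := location_scale_decision z0Z.
case: (hLS) => xi_mean xi_var _ _ _.
rewrite sE in s0.
have [q [k [q0 k0 tail]]] :=
  normal_right_tail_ge (ell_meas z0Z) s0 xi_mean xi_var XE (normal _ z0Z).
pose e : R := N + `|ln q / alpha|.
exists (alpha / (8 * k)), (1 + 8 * k / alpha * e).
have e0 : 0 <= e by rewrite addr_ge0// ltW.
have ak : 0 <= 8 * k / alpha * e.
  by rewrite mulr_ge0// divr_ge0 ?mulr_ge0 ?(ltW k0) ?(ltW alpha_gt0).
split; [by rewrite divr_gt0 ?mulr_gt0|by rewrite ltr_pwDl|].
move=> z zZ sz; set t : R := sigma z in sz *.
have t1 : 1 <= t by lra.
(* [y] maximizes [t * y - k * y ^+ 2 / alpha]. *)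
pose y : R := alpha * t / (2 * k).
have y0 : 0 <= y.
  by rewrite divr_ge0 ?mulr_ge0 ?(ltW k0) ?(ltW alpha_gt0)//; lra.
have qy0 : 0 < q * expR (- (k * y ^+ 2)) by rewrite mulr_gt0 ?expR_gt0.
apply: le_trans (gap_ge_of_tail zZ qy0 (tail _ y0)).
rewrite -/t lee_fin lnM ?posrE ?expR_gt0// expRK.
rewrite -subr_ge0.
have -> : t * y + (ln q - k * y ^+ 2) / alpha - N * t -
    alpha / (8 * k) * t ^+ 2 =
  alpha / (8 * k) * t ^+ 2 + ln q / alpha - N * t.
  by rewrite /y; field; rewrite !gt_eqF.
have : e <= alpha / (8 * k) * t.
  rewrite -(@ler_pM2l _ (8 * k / alpha)) ?divr_gt0 ?mulr_gt0//.
  have -> : 8 * k / alpha * (alpha / (8 * k) * t) = t.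
    by field; rewrite !gt_eqF.
  by lra.
have := ler_norm (- (ln q / alpha)); rewrite normrN /e => h1 h2.
have h3 : `|ln q / alpha| <= `|ln q / alpha| * t by rewrite ler_peMr.
have : (N + `|ln q / alpha|) * t <= alpha / (8 * k) * t * t.
  by rewrite ler_wpM2r//; lra.
rewrite expr2; lra.
Qed.

(** Near the critical variance [alpha * sigma z] is at most 3, so the expected
estimator stays within [3 * N / alpha] of the mean loss while the exponential
moment grows with the number [L] of cells, which is chosen from the target
[K]. *)
Lemma gap_diverges_of_laplace : laplace_distributed Q xi ->
  diverges_as Z (fun z => fine 'V_P[ell z]) (2 / alpha ^+ 2) gap.
Proof.
move=> lap K; pose r : R := K + 3 * N / alpha.
set q : R := Num.sqrt (2 : R).
have q0 : 0 < q by rewrite sqrtr_gt0.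
have q2 : q ^+ 2 = 2 by rewrite sqr_sqrtr.
pose c : R := q^-1 * expR (- (q + 1)).
have c0 : 0 < c by rewrite mulr_gt0 ?invr_gt0 ?expR_gt0.
pose L := (Num.truncn (expR (alpha * r) / c)).+1.
have Lr : expR (alpha * r) <= L%:R * c.
  by rewrite -ler_pdivrMr// ltW// truncnS_gt.
have L0 : 0 < L%:R :> R by rewrite ltr0n.
have L1 : 1 <= L%:R :> R by rewrite ler1n.
have a2 : 0 < alpha ^+ 2 by rewrite exprn_gt0.
exists (alpha ^+ 2 * L%:R)^-1 => [|z zZ]; first by rewrite invr_gt0 mulr_gt0.
have [m [s [s0 _ sE ->]]] := location_scale_decision zZ => close.
pose lambda : R := alpha * s.
have l0 : 0 <= lambda by rewrite mulr_ge0// ltW.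
have q1 : 1 <= q.
  by rewrite -(@ler_pXn2r _ 2)// ?nnegrE ?(ltW q0)// q2 expr1n ler1n.
have q3 : q <= 2 by rewrite -(@ler_pXn2r _ 2)// ?nnegrE ?(ltW q0)// q2; lra.
have lL : `|lambda - q| * L%:R <= 1.
  have : `|lambda ^+ 2 - 2| * L%:R <= 1.
    have -> : lambda ^+ 2 - 2 = alpha ^+ 2 * (s ^+ 2 - 2 / alpha ^+ 2).
      by rewrite /lambda; field; rewrite gt_eqF.
    rewrite normrM (gtr0_norm a2) mulrAC.
    move/ltW: close; rewrite -(ler_pM2l (mulr_gt0 a2 L0)) mulfV//.
    by rewrite gt_eqF// mulr_gt0.
  apply: le_trans; rewrite ler_wpM2r//.
  rewrite -q2 subr_sqr normrM (ger0_norm (_ : 0 <= lambda + q)); last by lra.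
  by rewrite ler_peMr//; lra.
have lq : `|lambda - q| <= 1.
  by apply: le_trans lL; rewrite ler_peMr.
have l3 : lambda <= 3 by have := ler_norm (lambda - q); lra.
apply: (@le_trans _ _ (r - N * sigma z)%:E).
  rewrite lee_fin sE /r.
  have : N * s <= 3 * N / alpha.
    have : N * lambda <= N * 3 by rewrite ler_pM2l.
    by rewrite ler_pdivlMr// /lambda; lra.
  by lra.
apply: gap_ge_of_exp_moment => //; rewrite sE.
apply: le_trans (laplace_exp_moment_ge lap l0 lL).
by rewrite lee_fin.
Qed.

(** As for the normal law, one decision with positive variance yields
subgaussian constants for [xi] itself, hence uniform ones. *)
Lemma gap_bigO_of_subgaussian :
  (forall z, Z z -> subgaussian_tails P (ell z)) ->
  is_bigO Z sigma (fun z => `|gap z|%E) (fun s => s ^+ 2).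
Proof.
move=> subg; have [[z0 [z0Z s0]]|none] :=
  pselect (exists z, Z z /\ 0 < sigma z); last first.
  exists 1, 1; split => // z zZ sz; exfalso; apply: none; exists z; split => //.
  exact: lt_le_trans sz.
have [m [s [_ XE sE _]]] := location_scale_decision z0Z.
case: (hLS) => xi_mean xi_var _ _ _.
rewrite sE in s0.
have [b [k [b0 k0 tail]]] := subgaussian_standardized s0 XE (subg _ z0Z).
pose B : R := expR 1 * b * 2.
have B0 : 0 < B by rewrite !mulr_gt0 ?expR_gt0.
pose C : R := alpha / (2 * k) + `|ln B / alpha| + N.
have C1 : 0 <= alpha / (2 * k) by rewrite divr_ge0 ?mulr_ge0 ?ltW.
have C2 : 0 <= `|ln B / alpha| by [].
exists C, 1; split=> [||z zZ sz]; [by rewrite ltr_wpDl ?addr_ge0|by []|].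
set t : R := sigma z in sz *.
have tt : t <= t ^+ 2 by rewrite expr2 ler_peMr//; lra.
have Nt : N * t <= N * t ^+ 2 by rewrite ler_pM2l.
have lower : ((- (N * t))%:E <= gap z)%E.
  rewrite -[- _]add0r; apply: gap_ge_of_exp_moment => //.
  rewrite mulr0 expR0 -(integral_affine xi_mean xi_var 1 (alpha * t)).
  by apply: le_integralT => w; rewrite lee_fin expR_ge1Dx.
have upper : (gap z <= (alpha / (2 * k) * t ^+ 2 + ln B / alpha + N * t)%:E)%E.
  apply: gap_le_of_exp_moment => //.
  apply: le_trans (exp_moment_le_subgaussian _ k0 (ltW b0) tail) _.
  have -> : alpha * (alpha / (2 * k) * t ^+ 2 + ln B / alpha) =
      (alpha * t) ^+ 2 / (2 * k) + ln B.
    by field; rewrite !gt_eqF.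
  by rewrite expRD lnK.
have hB := ler_norm (ln B / alpha).
have h1 : `|ln B / alpha| <= `|ln B / alpha| * t ^+ 2.
  by rewrite ler_peMr// expr_ge1//; lra.
case: (gap z) lower upper => [g| |]//; rewrite !lee_fin => lower upper.
have CE : C * t ^+ 2 = alpha / (2 * k) * t ^+ 2 + `|ln B / alpha| * t ^+ 2 +
  N * t ^+ 2 by rewrite /C; ring.
have h2 : 0 <= alpha / (2 * k) * t ^+ 2 by rewrite mulr_ge0// sqr_ge0.
rewrite CE ler_norml; apply/andP; split; lra.
Qed.

End regimes.

Theorem proposition7 (R : realType)
  (alpha : R) (alpha_gt0 : 0 < alpha)
  (n : nat)
  (d m : nat) (Z : set 'rV[R]_d)
  (P : probability (m.-tuple R) R)
  (ell : 'rV[R]_d -> m.-tuple R -> R)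
  (ell_meas : forall z, Z z -> measurable_fun setT (ell z))
  (dU : measure_display) (U : measurableType dU)
  (Pxi : probability U R) (xi : {RV Pxi >-> R})
  (A : set (R * R))
  (hLS : location_scale Z P ell Pxi xi A)
  (M : bootstrap_method) :
  [/\ unbounded_right_tail Pxi xi ->
        is_smallomega Z (fun z => std_dev P (ell z))
          (fun z => risk_gap M n alpha P (ell z)) (fun s => s),
      (forall z, Z z -> normally_distributed P (ell z)) ->
        is_bigOmega Z (fun z => std_dev P (ell z))
          (fun z => risk_gap M n alpha P (ell z)) (fun s => s ^+ 2),
      laplace_distributed Pxi xi ->
        diverges_as Z (fun z => fine 'V_P[ell z]%E) (2 / alpha ^+ 2)
          (fun z => risk_gap M n alpha P (ell z)) &
      (forall z, Z z -> subgaussian_tails P (ell z)) ->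
        is_bigO Z (fun z => std_dev P (ell z))
          (fun z => `|risk_gap M n alpha P (ell z)|%E) (fun s => s ^+ 2)].
Proof.
split.
- exact: (gap_superlinear_of_unbounded_tail alpha_gt0 n M ell_meas hLS).
- exact: (gap_quadratic_of_normal alpha_gt0 n M ell_meas hLS).
- exact: (gap_diverges_of_laplace alpha_gt0 n M ell_meas hLS).
- exact: (gap_bigO_of_subgaussian alpha_gt0 n M ell_meas hLS).
Qed.
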